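(* Let $k\ge 2$ and let $L_1,\dots,L_k$ be pairwise different integers, all greater than $1$. Let $T:\mathbb{Z}_+^k\to C^0(\mathbb{S}^1,\mathbb{S}^1)$ be the continuous $\mathbb{Z}_+^k$-action on the circle $\mathbb{S}^1=\mathbb{R}/\mathbb{Z}$ with generators $T_i$ $(1\le i\le k)$ defined by $T_i(x)=L_i x \ (\mathrm{mod}\ 1)$. Then $$h(T)=\log\sum_{i=1}^k L_i .$$
   Context: $\mathbb{Z}_+=\{0,1,2,\dots\}$. For a compact metric space $(X,d_X)$, $C^0(X,X)$ is the set of continuous maps $X\to X$. A continuous $\mathbb{Z}_+^k$-action on $X$ is a monoid homomorphism $T:\mathbb{Z}_+^k\to C^0(X,X)$; its generators are the (commuting) maps $T_i=T(0,\dots,0,1,0,\dots,0)$ with $1$ in the $i$-th place, $1\le i\le k$. Here $X=\mathbb{S}^1=\mathbb{R}/\mathbb{Z}$ carries the geodesic metric (the length of the shorter arc joining two points). Friedland's entropy: the orbit space of $T$ is $$X_T=\Bigl\{\{x_n\}_{n\in\mathbb{Z}_+}\in\prod_{n\in\mathbb{Z}_+}X:\ \text{for every } n\in\mathbb{Z}_+ \text{ there is } i_n\in\{1,\dots,k\} \text{ with } T_{i_n}(x_n)=x_{n+1}\Bigr\},$$ a compact space with metric $d_{X_T}(\bar x,\bar y)=\sum_{n=0}^\infty 2^{-n}d_X(x_n,y_n)$. The shift $\sigma_T:X_T\to X_T$ is $\sigma_T(\{x_n\}_n)=\{x_{n+1}\}_n$. The entropy of the action is $h(T):=h(\sigma_T)$,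 the usual topological entropy of the continuous map $\sigma_T$, i.e. $h(T)=\lim_{\varepsilon\to0}\limsup_{n\to\infty}\frac1n\log s(n,\varepsilon)$, where $s(n,\varepsilon)$ is the largest cardinality of a set $F\subset X_T$ such that $\max_{0\le i\le n-1}d_{X_T}(\sigma_T^i\bar x,\sigma_T^i\bar y)>\varepsilon$ for all distinct $\bar x,\bar y\in F$. *)

(* Defs.v *)
From HB Require Import structures.
From mathcomp Require Import all_boot all_order all_algebra finmap.
From mathcomp Require Import all_classical all_reals.
From mathcomp Require Import ereal topology normedtype sequences exp.
From mathcomp Require Import lra.

Set Implicit Arguments.
Unset Strict Implicit.
Unset Printing Implicit Defensive.

Import Order.TTheory GRing.Theory Num.Theory.
Import numFieldTopology.Exports numFieldNormedType.Exports.

Local Open Scope classical_set_scope.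
Local Open Scope ring_scope.

HB.mixin Record Metric_isCompact (R : numDomainType) M & Metric R M := {
  compact_setT : compact [set: M]
}.

#[short(type="compactMetricType")]
HB.structure Definition CompactMetric (R : numDomainType) :=
  { M of Metric R M & Metric_isCompact R M }.

Lemma mdist_bounded (R : realType) (X : compactMetricType R) (p : X) :
  exists B : R, forall y : X, mdist p y <= B.
Proof.
have /compact_near_coveringP/(_ _ (+oo%R : set_system R)
    (fun B y => mdist p y <= B)) := @compact_setT R X.
case=> [x _|B [_ HB]].
  exists (ball x 1, [set B | mdist p x + 1 < B]) => /=.
    split; first by apply: nbhsx_ballx.
    by exists (mdist p x + 1); split => //; rewrite num_real.
  case=> y B /= [+ pB]; rewrite ballEmdist/= => xy.
  rewrite (le_trans (metric_triangle p x y))//.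
  by rewrite (le_trans _ (ltW pB))// lerD2l ltW.
by exists (B + 1) => y; apply: HB => //; rewrite ltrDl.
Qed.

Section circle.
Variable R : realType.
Implicit Types (a b : R) (m : int).

Definition integers : {pred R} := fun a => a \is a Num.int.

Lemma integers_zmod_closed : zmod_closed integers.
Proof. by split=> [|x y]; [exact: int_num0|exact: rpredB]. Qed.

HB.instance Definition _ :=
  GRing.isZmodClosed.Build R integers integers_zmod_closed.

(* R/Z, as the quotient of the additive group of R by its subgroup of
   integers. *)
Definition circle : Type := @Quotient.quot R integers.

HB.instance Definition _ := GRing.Zmodule.on circle.

Definition mod1 a : circle := (\pi_(@Quotient.quot R integers) a)%qT.

Definition frac a : R := a - (Num.floor a)%:~R.

(* The length of the shorter of the two arcs of R/Z joining 0 and a mod 1. *)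
Definition arc a : R := Num.min (frac a) (1 - frac a).

Definition circle_dist (x y : circle) : R := arc (repr x - repr y).

Lemma mod1D a b : mod1 (a + b) = mod1 a + mod1 b.
Proof. by rewrite /mod1 !piE. Qed.

Lemma mod1N a : mod1 (- a) = - mod1 a.
Proof. by rewrite /mod1 !piE. Qed.

Lemma mod1_eq a b : mod1 a = mod1 b <-> exists m, a - b = m%:~R.
Proof.
rewrite /mod1; split.
  move=> /eqP; rewrite -Quotient.idealrBE => /intrP[m ->]; by exists m.
by move=> [m abm]; apply/eqP; rewrite -Quotient.idealrBE abm; apply/intrP; exists m.
Qed.

Lemma mod1K (x : circle) : mod1 (repr x) = x.
Proof. exact: reprK. Qed.

Lemma arc_le a m : arc a <= `|a - m%:~R|.
Proof.
rewrite /arc /frac; have := floor_le a; have := floorD1_gt a.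
set f := Num.floor a; rewrite intrD => fa af.
have [mf|fm] := lerP m f.
  have mfR : (m%:~R : R) <= f%:~R by rewrite ler_int.
  rewrite ger0_norm ?subr_ge0 ?(le_trans mfR)//.
  by rewrite ge_min lerD2l lerN2 mfR.
have fmR : (f%:~R + 1 : R) <= m%:~R by rewrite -[1]/(1%:~R) -intrD ler_int lezD1.
rewrite ler0_norm ?subr_le0 ?(ltW (lt_le_trans fa _))//.
by rewrite ge_min; apply/orP; right; lra.
Qed.

Lemma arcE a : exists m, arc a = `|a - m%:~R|.
Proof.
rewrite /arc /frac; have := floor_le a; have := floorD1_gt a.
set f := Num.floor a; rewrite intrD => fa af.
case: (leP (a - f%:~R)) => _.
  by exists f; rewrite ger0_norm// subr_ge0.
by exists (f + 1); rewrite ler0_norm intrD; lra.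
Qed.

Lemma arc_ge0 a : 0 <= arc a.
Proof. by have [m ->] := arcE a. Qed.

Lemma arcN a : arc (- a) = arc a.
Proof.
have le b : arc (- b) <= arc b.
  have [m ->] := arcE b; rewrite -normrN opprB addrC -[m%:~R]opprK -mulrNz.
  exact: arc_le.
by apply/eqP; rewrite eq_le le/= -{1}[a]opprK le.
Qed.

Lemma arcD a b : arc (a + b) <= arc a + arc b.
Proof.
have [m ->] := arcE a; have [n ->] := arcE b.
apply: le_trans (arc_le _ (m + n)) _.
by rewrite (le_trans _ (ler_normD _ _))// intrD opprD addrACA.
Qed.

Lemma arc_mod1 a b : mod1 a = mod1 b -> arc a = arc b.
Proof.
have le c d : mod1 c = mod1 d -> arc c <= arc d.
  move=> /mod1_eq[m cd]; have [n ->] := arcE d.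
  have -> : d - n%:~R = c - (m + n)%:~R by rewrite intrD -cd; lra.
  exact: arc_le.
by move=> ab; apply/eqP; rewrite eq_le !le.
Qed.

Lemma circle_dist_mod1 a b : circle_dist (mod1 a) (mod1 b) = arc (a - b).
Proof. by apply: arc_mod1; rewrite !mod1D !mod1N !mod1K. Qed.

Lemma circle_distxx x : circle_dist x x = 0.
Proof. by rewrite /circle_dist subrr /arc /frac floor0 !subr0 min_l. Qed.

Lemma circle_dist_positivity x y : circle_dist x y = 0 -> x = y.
Proof.
rewrite /circle_dist -{2}(mod1K x) -{2}(mod1K y) => d0; apply/mod1_eq.
have [m] := arcE (repr x - repr y); rewrite d0 => /esym/eqP.
by rewrite normr_eq0 subr_eq0 => /eqP; exists m.
Qed.

Lemma circle_dist_sym x y : circle_dist x y = circle_dist y x.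
Proof. by rewrite /circle_dist -arcN opprB. Qed.

Lemma circle_dist_triangle y x z :
  circle_dist x z <= circle_dist x y + circle_dist y z.
Proof. by rewrite (le_trans _ (arcD _ _))// addrA subrK. Qed.

HB.instance Definition _ := Choice.on circle.
HB.instance Definition _ := isMetric.Build R circle
  circle_distxx circle_dist_positivity circle_dist_sym circle_dist_triangle.

Lemma mod1_continuous : continuous mod1.
Proof.
move=> a; apply/metricType_numDomainType.cvgrPdist_lt => e e0; near=> b.
rewrite [mdist _ _]circle_dist_mod1 (le_lt_trans (arc_le _ 0))// subr0.
by near: b; apply: cvgr_dist_lt.
Unshelve. all: by end_near. Qed.

Lemma circle_compact : compact [set: circle].
Proof.
have -> : [set: circle] = mod1 @` `[0, 1].
  apply/seteqP; split => // x _; exists (frac (repr x)) => /=.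
    rewrite in_itv/= /frac subr_ge0 floor_le/=.
    by have := floorD1_gt (repr x); rewrite intrD; lra.
  rewrite -[RHS]mod1K; apply/mod1_eq; exists (- Num.floor (repr x)).
  by rewrite /frac mulrNz; lra.
apply: continuous_compact; last exact: segment_compact.
exact/continuous_subspaceT/mod1_continuous.
Qed.

HB.instance Definition _ := Metric_isCompact.Build R circle circle_compact.
End circle.

(* Continuous actions of the additive monoid Z_+^k. *)
Record continuous_action (k : nat) (R : realType) (X : compactMetricType R) :=
  ContinuousAction {
    action_map :> {ffun 'I_k -> nat} -> continuousType X X ;
    action_map0 : action_map 0 =1 id ;
    action_mapD : forall m n, action_map (m + n) =1 action_map m \o action_map n
  }.

Section friedland.
Variables (R : realType) (X : compactMetricType R) (k : nat).
Variable T : continuous_action k X.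

Definition generator (i : 'I_k) : X -> X :=
  T [ffun j : 'I_k => (j == i : nat)].

Record orbit_space := OrbitSpace {
  orbit_seq :> nat -> X ;
  orbit_seqP : forall n, exists i, generator i (orbit_seq n) = orbit_seq n.+1
}.

HB.instance Definition _ := gen_eqMixin orbit_space.
HB.instance Definition _ := gen_choiceMixin orbit_space.

Implicit Types x y z : orbit_space.

Definition orbit_dist_term x y : R^nat :=
  fun n => 2 ^- n * mdist (x n) (y n).

Definition orbit_dist x y : R := limn (series (orbit_dist_term x y)).

Lemma orbit_dist_term_ge0 x y n : 0 <= orbit_dist_term x y n.
Proof.
by rewrite /orbit_dist_term mulr_ge0 ?invr_ge0 ?exprn_ge0// mdist_ge0.
Qed.

Lemma is_cvg_orbit_dist x y : cvgn (series (orbit_dist_term x y)).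
Proof.
have [B HB] := mdist_bounded (x 0%N).
apply: (@series_le_cvg _ _ (geometric (B + B) 2^-1)).
- exact: orbit_dist_term_ge0.
- move=> n; rewrite /= mulr_ge0 ?exprn_ge0 ?invr_ge0//.
  by rewrite addr_ge0// (le_trans _ (HB (x 0%N)))// mdist_ge0.
- move=> n; rewrite /orbit_dist_term /= exprVn mulrC ler_wpM2r ?invr_ge0 ?exprn_ge0//.
  by rewrite (le_trans (metric_triangle _ (x 0%N) _))// lerD// metric_sym.
- by apply: is_cvg_geometric_series; rewrite gtr0_norm ?invr_gt0// invf_lt1// ltr1n.
Qed.

Lemma orbit_distxx x : orbit_dist x x = 0.
Proof.
rewrite /orbit_dist; apply: cvg_lim => //; apply: cvg_near_cst; near=> n.
by rewrite /series/= big1// => i _; rewrite /orbit_dist_term mdistxx mulr0.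
Unshelve. all: by end_near. Qed.

Lemma orbit_dist_positivity x y : orbit_dist x y = 0 -> x = y.
Proof.
move=> xy0; have xy : orbit_seq x = orbit_seq y.
  apply/funext => n; apply: mdist_positivity; apply/eqP.
  rewrite eq_le mdist_ge0 andbT -(pmulr_rle0 _ (_ : 0 < 2 ^- n)); last first.
    by rewrite invr_gt0 exprn_gt0.
  rewrite -xy0 (le_trans _ (nondecreasing_cvgn_le _ _ n.+1))//.
  - rewrite /series/= big_nat_recr//= lerDr sumr_ge0// => i _.
    exact: orbit_dist_term_ge0.
  - apply/nondecreasing_seqP => m; rewrite /series/= big_nat_recr//= lerDl.
    exact: orbit_dist_term_ge0.
  - exact: is_cvg_orbit_dist.
case: x y xy {xy0} => x hx [y hy] /= xy; subst y.
by congr OrbitSpace; exact: Prop_irrelevance.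
Qed.

Lemma orbit_dist_sym x y : orbit_dist x y = orbit_dist y x.
Proof.
congr (limn (series _)); apply/funext => n.
by rewrite /orbit_dist_term metric_sym.
Qed.

Lemma orbit_dist_triangle y x z :
  orbit_dist x z <= orbit_dist x y + orbit_dist y z.
Proof.
rewrite /orbit_dist -limD; [|exact: is_cvg_orbit_dist..].
apply: ler_lim; [exact: is_cvg_orbit_dist| |].
  by apply: is_cvgD; exact: is_cvg_orbit_dist.
near=> n; rewrite /series/= -[leRHS]big_split/= ler_sum// => i _.
by rewrite /orbit_dist_term -mulrDr ler_wpM2l ?invr_ge0 ?exprn_ge0// metric_triangle.
Unshelve. all: by end_near. Qed.

HB.instance Definition _ := isMetric.Build R orbit_space
  orbit_distxx orbit_dist_positivity orbit_dist_sym orbit_dist_triangle.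

Definition orbit_shift (x : orbit_space) : orbit_space :=
  @OrbitSpace (fun n => x n.+1) (fun n => orbit_seqP x n.+1).
End friedland.

Section topological_entropy.
Variables (R : realType) (M : metricType R) (f : M -> M).

(* As distances are nonnegative, taking 0 as the neutral element only matters
   for n = 0. *)
Definition bowen_dist (n : nat) (x y : M) : R :=
  \big[Num.max/0]_(i < n) mdist (iter i f x) (iter i f y).

Definition bowen_separated (n : nat) (e : R) (F : {fset M}) : Prop :=
  {in F &, forall x y, x != y -> e < bowen_dist n x y}.

(* The largest cardinality of a separated set, as a supremum in \bar R since
   M is not assumed to be compact. *)
Definition max_separated (n : nat) (e : R) : \bar R :=
  ereal_sup [set (#|` F|%:R)%:E | F in bowen_separated n e].

Definition topological_entropy : \bar R :=
  lim (limn_esup (fun n => (n%:R^-1)%:E * lne (max_separated n e))%E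
         @[e --> 0^'+]).
End topological_entropy.

Definition friedland_entropy (R : realType) (X : compactMetricType R) (k : nat)
    (T : continuous_action k X) : \bar R :=
  topological_entropy (@orbit_shift R X k T).

(* Main.v *)
From mathcomp Require Import all_boot all_order all_algebra finmap.
From mathcomp Require Import all_classical all_reals.
From mathcomp Require Import ereal topology normedtype sequences exp.
From mathcomp Require Import lra ring zify.
Require Import Defs.

(* Write S for the sum of the L_i.
   Upper bound: up to time N an orbit is determined by the word w of its first N
   generators and its initial point; cutting the circle into q L_w equal arcs
   keeps two orbits with the same word and arc 1/q-close up to time N, and there
   are q S^N pairs (word, arc).
   Lower bound: orbits are counted backwards from their last point. Let D be
   divisible by all L_i - L_j. The preimages of a point p under all the
   generators are distinct, and uniformly separated, as long as p stays away from
   (1/D)Z/Z. This finite set is forward invariant, so p being at distance >= c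
   from it forces the first m generations of preimages of p to be at distance
   >= c / S^m. Hence it suffices to keep, every m steps, the preimages in the
   interval [1/(4D), 3/(4D)]: this retains a proportion >= 1/(8D) of the S^m
   preimages, and the entropy is at least log S - log(8D)/m for every large m. *)

Set Implicit Arguments.
Unset Strict Implicit.
Unset Printing Implicit Defensive.

Import Order.TTheory GRing.Theory Num.Theory.
Import numFieldTopology.Exports numFieldNormedType.Exports.

Local Open Scope classical_set_scope.
Local Open Scope ring_scope.

(** * Entropy from the growth of separated sets *)

Section entropy_bounds.
Variables (R : realType) (M : metricType R) (f : M -> M).
Local Open Scope ereal_scope.

Lemma limn_esup_ge (u : (\bar R)^nat) (c : \bar R) :
  (forall N, exists2 n, (N <= n)%N & c <= u n) -> c <= limn_esup u.
Proof.
move=> uc; rewrite limn_esup_lim; apply: lime_ge; first exact: is_cvg_esups.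
apply: nearW => N; have [n Nn cn] := uc N.
by apply: (le_trans cn); apply: ereal_sup_ubound; exists n.
Qed.

Lemma limn_esup_le (u v : (\bar R)^nat) (l : \bar R) :
  (forall n, u n <= v n) -> v @ \oo --> l -> limn_esup u <= l.
Proof.
move=> uv vl; rewrite -(cvg_limn_einf_sup vl).2 !limn_esup_lim.
apply: lee_lim; [exact: is_cvg_esups..|apply: nearW => N].
apply: ge_ereal_sup => _ [n Nn <-]; apply: (le_trans (uv n)).
by apply: ereal_sup_ubound; exists n.
Qed.

Definition separated_growth (e : R) : \bar R :=
  limn_esup (fun n => (n%:R^-1)%:E * lne (max_separated f n e)).

Lemma separated_growth_le (e s C : R) : (1 <= s)%R -> (1 <= C)%R ->
  (forall n (F : {fset M}), bowen_separated f n e F ->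
     #|` F|%:R <= C * s ^+ n)%R ->
  separated_growth e <= (ln s)%:E.
Proof.
move=> s1 C1 HF; have s0 := lt_le_trans ltr01 s1; have C0 := lt_le_trans ltr01 C1.
apply: (@limn_esup_le _ (fun n => (n%:R^-1 * (ln C + ln s *+ n))%:E)) => [n|].
  rewrite EFinM lee_wpmul2l ?lee_fin ?invr_ge0//.
  have sn0 : (0 < C * s ^+ n)%R by rewrite mulr_gt0// exprn_gt0.
  have -> : (ln C + ln s *+ n)%:E = lne (C * s ^+ n)%:E.
    by rewrite lne_EFin// lnM ?posrE ?exprn_gt0// lnXn.
  have : max_separated f n e <= (C * s ^+ n)%:E.
    by apply: ge_ereal_sup => _ [F /HF sF <-]; rewrite lee_fin.
  (* A supremum that is not positive has logarithm -oo; monotonicity of [lne] is applied only in the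
     other case. *)
  have [m0|m0] := leP (max_separated f n e) 0; first by rewrite le0_lneNy ?leNye.
  by move=> h; rewrite lee_lne// in_itv/= ?(ltW m0) ?leey// lee_fin (ltW sn0).
apply: cvg_EFin; first exact: nearW.
apply: (@cvg_trans _ ((fun n => n%:R^-1 * ln C + ln s)%R @ \oo)).
  (* The two sequences agree for n >= 1 only: at n = 0 the factor n^-1 is 0. *)
  apply: near_eq_cvg; near=> n => /=.
  have n0 : (n%:R != 0 :> R)%R by rewrite pnatr_eq0 -lt0n; near: n; exists 1%N.
  by rewrite mulrDr -(mulr_natl (ln s)) mulKf.
have h : ((fun n : nat => n%:R^-1 * ln C + ln s)%R @ \oo --> (0 * ln C + ln s)%R).
  apply: cvgD; last exact: cvg_cst.
  apply: cvgMl; rewrite -cvg_shiftS; exact: cvg_harmonic.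
by rewrite mul0r add0r in h.
Unshelve. all: by end_near. Qed.

(** The multiples of m are cofinal, so they suffice to bound the limsup from below; a factor s per m
    steps gives the rate ln s / m. *)
Lemma separated_growth_ge (e s : R) (m : nat) : (0 < m)%N -> (0 < s)%R ->
  (forall n, exists2 F : {fset M}, bowen_separated f (n * m) e F &
     (s ^+ n <= #|` F|%:R)%R) ->
  (ln s / m%:R)%:E <=
    separated_growth e.
Proof.
move=> m0 s0 HF; apply: limn_esup_ge => N.
exists (N.+1 * m)%N; first by nia.
have [F sF cF] := HF N.+1.
have : (s ^+ N.+1)%:E <= max_separated f (N.+1 * m) e.
  apply: (@le_trans _ _ (#|` F|%:R)%:E); first by rewrite lee_fin.
  by apply: ereal_sup_ubound; exists F.
move=> h; have sn0 : 0 <= (s ^+ N.+1)%:E by rewrite lee_fin exprn_ge0// ltW.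
have : lne (s ^+ N.+1)%:E <= lne (max_separated f (N.+1 * m) e).
  by rewrite lee_lne// in_itv/= leey andbT// (le_trans sn0).
rewrite lne_EFin ?exprn_gt0// => {}h.
apply: (@le_trans _ _ (((N.+1 * m)%:R^-1)%:E * (ln (s ^+ N.+1))%:E)).
  rewrite -EFinM lee_fin lnXn// natrM invfM -(mulr_natl (ln s)) mulrACA mulVf ?mul1r//.
  by rewrite mulrC.
by rewrite lee_wpmul2l// lee_fin invr_ge0.
Qed.

Lemma bowen_separated_le n (e e' : R) (F : {fset M}) : (e <= e')%R ->
  bowen_separated f n e' F -> bowen_separated f n e F.
Proof. by move=> ee' sF x y xF yF xy; exact: le_lt_trans ee' (sF _ _ xF yF xy). Qed.

Lemma topological_entropyE (h : R) :
  (forall e : R, (0 < e)%R ->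
     separated_growth e <= h%:E) ->
  (forall d : R, (0 < d)%R -> exists2 e0 : R, (0 < e0)%R &
     forall e : R, (0 < e <= e0)%R -> (h - d)%:E <=
     separated_growth e) ->
  topological_entropy f = h%:E.
Proof.
move=> gle gge.
set g := separated_growth.
rewrite /topological_entropy -/separated_growth.
apply: cvg_lim => //; apply/fine_cvgP.
have gfin e : (0 < e)%R -> g e <= h%:E by exact: gle.
have e0E (e0 : R) : (0 < e0)%R -> \forall e \near 0^'+, (0 < e <= e0)%R.
  move=> e00; near=> e; apply/andP; split; near: e.
  - exact: nbhs_right_gt.
  - exact: nbhs_right_le.
split.
  (* Any fixed d excludes the value -oo near 0, so the limit can be taken among reals. *)
  have [e0 e00 He0] := gge 1%R ltr01.
  apply: filterS (e0E _ e00) => e ee0.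
  rewrite fin_numElt (lt_le_trans _ (He0 _ ee0)) ?ltNyr//.
  by rewrite (le_lt_trans (gfin e _)) ?ltry//; case/andP: ee0.
apply/cvgrPdist_le => d d0; have [e0 e00 He0] := gge d d0.
apply: filterS (e0E _ e00) => e ee0 /=.
have := He0 _ ee0; have := gfin e (andP ee0).1; rewrite -/g.
case: (g e) => [r| |] //=; rewrite !lee_fin => rh hr.
by rewrite ger0_norm ?subr_ge0//; lra.
Unshelve. all: by end_near. Qed.

End entropy_bounds.
(** * Arc length on the circle *)

Section circle_arc.
Variable R : realType.
Implicit Types (a b : R) (n : nat).

Lemma arc_le_norm a : arc a <= `|a|.
Proof. by have := arc_le a 0; rewrite subr0. Qed.

Lemma arc_le1 a : arc a <= 1.
Proof.
rewrite /arc /frac ge_min; apply/orP; left.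
by have := floorD1_gt a; rewrite intrD; lra.
Qed.

(** If m is an integer nearest to a, then c m is an integer at distance |c| [arc a] from c a. *)
Lemma arc_intM (c : int) a : arc (c%:~R * a) <= `|c|%:~R * arc a.
Proof.
have [m ->] := arcE a; apply: le_trans (arc_le _ (c * m)) _.
by rewrite intrM -mulrBr normrM intr_norm.
Qed.

Lemma arc_natM n a : arc (n%:R * a) <= n%:R * arc a.
Proof. by have := arc_intM n%:Z a. Qed.

Lemma arc_quarter a : 4^-1 <= a <= 3 / 4 -> 4^-1 <= arc a.
Proof.
move=> /andP[a1 a2]; have [m ->] := arcE a.
have [m0|m0] := leP m 0.
  have : (m%:~R : R) <= 0 by rewrite lerz0.
  by move=> h; rewrite ger0_norm; lra.
have : (1 : R) <= m%:~R by rewrite ler1z.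
by move=> h; rewrite ler0_norm; lra.
Qed.

Lemma mod1Dnat n a : mod1 (a + n%:R) = mod1 a.
Proof. by apply/mod1_eq; exists n%:Z; rewrite addrAC subrr add0r. Qed.

Lemma mod1_frac a : mod1 (frac a) = mod1 a.
Proof. by apply/mod1_eq; exists (- Num.floor a); rewrite /frac mulrNz; lra. Qed.

Lemma frac_itv a : 0 <= frac a < 1.
Proof.
by rewrite /frac; have := floor_le a; have := floorD1_gt a; rewrite intrD; lra.
Qed.

Lemma frac_inj a b n n' : 0 <= a < 1 -> 0 <= b < 1 ->
  a + n%:R = b + n'%:R -> a = b /\ n = n'.
Proof.
move=> a01 b01 ab.
have nn : n = n'.
  have [nn'|nn'|//] := ltngtP n n'.
    have : (n%:R + 1 : R) <= n'%:R by rewrite natr1 ler_nat.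
    by move=> h; exfalso; lra.
  have : (n'%:R + 1 : R) <= n%:R by rewrite natr1 ler_nat.
  by move=> h; exfalso; lra.
by split=> //; move: ab; rewrite nn => /addIr.
Qed.

Lemma mod1_inj a b : 0 <= a < 1 -> 0 <= b < 1 -> mod1 a = mod1 b -> a = b.
Proof.
move=> a01 b01 /mod1_eq[[m|m] ab].
  suff: a + 0%:R = b + m%:R by case/(frac_inj a01 b01).
  by rewrite addr0 addrC; apply/eqP; rewrite -subr_eq ab.
suff: a + m.+1%:R = b + 0%:R by case/(frac_inj a01 b01).
move: ab; rewrite NegzE mulrNz => ab.
by rewrite addr0 -[b]opprK -[a](subrK b) ab pmulrn; ring.
Qed.

Lemma int_eq0_norm_lt1 (m : int) : `|m%:~R : R| < 1 -> m = 0.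
Proof. by rewrite -intr_norm -[1]/(1%:~R) ltr_int; lia. Qed.

(* If [l != l'] and [p = l * y], multiplying the two congruences by [l'] and [l] shows that
   [(l' - l) * p] is within [l * l' * eps] of an integer. *)
Lemma preimage_separation (s D l l' : nat) (eps : R) y y' :
  (0 < l <= s)%N -> (0 < l' <= s)%N -> (0 < D)%N ->
  (forall d : nat, (0 < d <= s)%N -> (d %| D)%N) ->
  s%:R * eps < 1 ->
  D%:R * s%:R ^+ 2 * eps < arc (D%:R * (l%:R * y)) ->
  arc (y - y') <= eps -> mod1 (l%:R * y) = mod1 (l'%:R * y') ->
  l = l' /\ mod1 y = mod1 y'.
Proof.
move=> /andP[l0 ls] /andP[l'0 l's] D0 dvdD seps good yy' /mod1_eq[a la].
have [n nE] := arcE (y - y'); rewrite nE in yy'.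
have eps0 : 0 <= eps by apply: le_trans yy'.
have lR : l%:R <= s%:R :> R by rewrite ler_nat.
have l'R : l'%:R <= s%:R :> R by rewrite ler_nat.
have lR0 : 0 < l%:R :> R by rewrite ltr0n.
have l'R0 : 0 < l'%:R :> R by rewrite ltr0n.
have ll' : l = l'.
  apply/eqP/negPn/negP => ll'.
  have /dvdnP[c cE] : (`|l'%:Z - l%:Z| %| D)%N by apply: dvdD; lia.
  (* The quotient of D by l' - l carries a sign; only its absolute value, at most D, enters the
     estimate. *)
  have [c' c'E cc'] : exists2 c' : int, D%:Z = c' * (l'%:Z - l%:Z) & `|c'|%N = c.
    have [h|h] := leqP l l'; [exists c%:Z|exists (- c%:Z)]; lia.
  have cD : (c <= D)%N by apply: dvdn_leq => //; rewrite cE dvdn_mulr.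
  move: good; apply/negP; rewrite -leNgt.
  have -> : D%:R * (l%:R * y) = c'%:~R * ((l'%:R - l%:R) * (l%:R * y)).
    have -> : (D%:R : R) = (D%:Z)%:~R by [].
    by rewrite c'E intrM intrB -!mulrA.
  apply: le_trans (arc_intM _ _) _.
  have h : arc ((l'%:R - l%:R) * (l%:R * y)) <= s%:R ^+ 2 * eps.
    apply: le_trans (arc_le _ (- l%:Z * a + l%:Z * l'%:Z * n)) _.
    have -> : (l'%:R - l%:R) * (l%:R * y) -
        (- l%:Z * a + l%:Z * l'%:Z * n)%:~R = l%:R * l'%:R * (y - y' - n%:~R).
      rewrite intrD !intrM mulrNz -la /=; ring.
    rewrite normrM ger0_norm ?mulr_ge0 ?ler0n//.
    by rewrite expr2 !ler_pM ?mulr_ge0 ?normr_ge0 ?ler0n.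
  by rewrite -mulrA ler_pM ?arc_ge0 ?ler0z// -abszE cc' /= ler_nat.
split=> //; subst l'; apply/mod1_eq; exists n.
(* For equal multipliers this integer is l (y - y' - n), of absolute value at most s eps < 1; its
   vanishing gives y - y' = n. *)
have : a - l%:Z * n = 0.
  apply: int_eq0_norm_lt1; apply: le_lt_trans seps.
  have -> : (a - l%:Z * n)%:~R = l%:R * (y - y' - n%:~R).
    by rewrite intrB intrM -la /=; ring.
  by rewrite normrM ger0_norm ?ler0n// ler_pM.
move=> /eqP; rewrite subr_eq0 => /eqP aE.
apply: (mulfI (lt0r_neq0 lR0)).
by rewrite mulrBr la aE intrM.
Qed.

End circle_arc.
(** * Orbits and words *)

Section orbit_space_metric.
Variables (R : realType) (X : compactMetricType R) (k : nat).
Variable T : continuous_action k X.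
Implicit Types x y : orbit_space T.

Lemma mdist_le_orbit x y : mdist (x 0%N) (y 0%N) <= mdist x y.
Proof.
have h : nondecreasing_seq (series (orbit_dist_term x y)).
  apply/nondecreasing_seqP => m; rewrite /series/= big_nat_recr//= lerDl.
  exact: orbit_dist_term_ge0.
have := nondecreasing_cvgn_le h (@is_cvg_orbit_dist _ _ _ T x y) 1%N.
by rewrite /series/= big_nat1 {1}/orbit_dist_term expr0 invr1 mul1r.
Qed.

(** The weights 2^-j turn the growth 3/2 into the ratio 3/4, whose geometric series sums to 4. Since
    the tolerance grows with j, far coordinates need no control on a bounded space. *)
Lemma orbit_mdist_le (c : R) x y : 0 <= c ->
  (forall j, mdist (x j) (y j) <= c * (3 / 2) ^+ j) -> mdist x y <= 4 * c.
Proof.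
move=> c0 xy; apply: limr_le; first exact: is_cvg_orbit_dist.
apply: nearW => n; apply: (@le_trans _ _ (series (geometric c (3 / 4)) n)).
  rewrite /series/= ler_sum// => j _; rewrite /orbit_dist_term.
  have -> : (3 / 4 : R) ^+ j = 2 ^- j * (3 / 2) ^+ j.
    by rewrite -exprVn -exprMn; congr (_ ^+ _); lra.
  by rewrite mulrCA ler_wpM2l// invr_ge0 exprn_ge0.
have q0 : 0 < 3 / 4 :> R by lra.
have q1 : `|3 / 4 : R| < 1 by rewrite gtr0_norm; lra.
apply: le_trans (geometric_le_lim n c0 q0 q1) _.
have -> : 1 - 3 / 4 = 4^-1 :> R by lra.
by rewrite invrK mulrC.
Qed.

Lemma iter_orbit_shift i x j : iter i (@orbit_shift _ _ _ T) x j = x (i + j)%N.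
Proof. by elim: i j => [//|i IH] j; rewrite iterS /= IH addnS. Qed.

Lemma mdist_le_bowen n i x y : (i < n)%N ->
  mdist (x i) (y i) <= bowen_dist (@orbit_shift _ _ _ T) n x y.
Proof.
move=> lin; rewrite /bowen_dist; apply: le_trans (le_bigmax _ _ (Ordinal lin)).
by apply: le_trans (mdist_le_orbit _ _); rewrite /= !iter_orbit_shift addn0.
Qed.

End orbit_space_metric.

(** * Words in the generators and their multipliers *)

Section words.
Variables (k : nat) (l : 'I_k -> nat).

Definition wprod (w : seq 'I_k) : nat := (\prod_(i <- w) l i)%N.

Lemma wprod_cat v w : wprod (v ++ w) = (wprod v * wprod w)%N.
Proof. by rewrite /wprod big_cat. Qed.

Lemma wprod_rcons w i : wprod (rcons w i) = (wprod w * l i)%N.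
Proof. by rewrite /wprod -cats1 big_cat big_seq1. Qed.

Fixpoint words (n : nat) : seq (seq 'I_k) :=
  if n is m.+1 then [seq i :: w | i <- enum 'I_k, w <- words m] else [:: [::]].

Lemma mem_words n w : (w \in words n) = (size w == n).
Proof.
elim: n w => [|n IH] [|i w] //=.
  by apply/negP => /allpairsP[[j v] [_ _]].
rewrite eqSS -IH; apply/allpairsP/idP => [[[j v] [_ vn [_ ->]]]//|wn].
by exists (i, w); split; rewrite ?mem_enum.
Qed.

Lemma words_uniq n : uniq (words n).
Proof.
elim: n => [//|n IH] /=; apply: allpairs_uniq; rewrite ?enum_uniq//.
by move=> [i v] [j w] _ _ /= [-> ->].
Qed.

(** Expanding the power of the sum: this counts, with multiplicity, the preimages of a point under
    all words of length n. *)
Lemma sum_wprod n :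
  (\sum_(w <- words n) wprod w = (\sum_(i < k) l i) ^ n)%N.
Proof.
elim: n => [|n IH]; first by rewrite big_seq1 /wprod big_nil.
rewrite /= big_allpairs_dep big_enum /= expnS -IH big_distrl /=.
apply: eq_bigr => i _; rewrite big_distrr /=; apply: eq_bigr => w _.
by rewrite /wprod big_cons.
Qed.

Hypothesis l_gt1 : forall i, (1 < l i)%N.

Lemma wprod_ge w : (2 ^ size w <= wprod w)%N.
Proof.
elim: w => [|i w IH]; first by rewrite /wprod big_nil.
by rewrite /wprod big_cons expnS leq_mul.
Qed.

Lemma wprod_gt0 w : (0 < wprod w)%N.
Proof. by apply: leq_trans (wprod_ge w); rewrite expn_gt0. Qed.

Lemma wprod_le w : (wprod w <= (\sum_(i < k) l i) ^ size w)%N.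
Proof.
elim: w => [|i w IH]; first by rewrite /wprod big_nil.
by rewrite /wprod big_cons expnS leq_mul// (bigD1 i)//= leq_addr.
Qed.

Lemma wprod_take_le w t : (wprod (take t w) <= wprod w)%N.
Proof.
by rewrite -{2}(cat_take_drop t w) wprod_cat leq_pmulr// wprod_gt0.
Qed.

End words.

(** * Orbits of the circle action and the upper bound *)

Section circle_orbits.
Variables (R : realType) (k : nat) (T : continuous_action k (circle R)).
Variable l : 'I_k -> nat.
Hypothesis l_gt1 : forall i, (1 < l i)%N.
Hypothesis T_gen : forall (i : 'I_k) (a : R),
  generator T i (mod1 a) = mod1 ((l i)%:R * a).
Implicit Types (s : nat -> 'I_k) (z : R).

Notation S := (\sum_(i < k) l i)%N.

(** The point at time t, from a real lift z of the start and an infinite sequence s of generators,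
    of which only the first t letters matter. *)
Definition orbit_point s z t : circle R :=
  mod1 ((wprod l (mkseq s t))%:R * z).

Lemma orbit_pointS s z t :
  generator T (s t) (orbit_point s z t) = orbit_point s z t.+1.
Proof.
rewrite /orbit_point T_gen mkseqS wprod_rcons natrM mulrA.
by rewrite [_ * (l _)%:R]mulrC.
Qed.

Definition orbit_of s z : orbit_space T :=
  OrbitSpace (fun t => ex_intro _ (s t) (orbit_pointS s z t)).

Lemma orbit_of_ex (x : orbit_space T) :
  exists sz : (nat -> 'I_k) * R, 0 <= sz.2 < 1 /\ x =1 orbit_point sz.1 sz.2.
Proof.
have [s sP] := boolp.choice (orbit_seqP x).
exists (s, frac (repr (x 0%N))); split; first exact: frac_itv.
elim=> [|t IH] /=; last by rewrite -sP IH orbit_pointS.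
by rewrite /orbit_point /wprod big_nil mul1r mod1_frac mod1K.
Qed.

Lemma mdist_orbit_point s s' z z' t :
  mkseq s t = mkseq s' t ->
  mdist (orbit_point s z t) (orbit_point s' z' t) =
  arc ((wprod l (mkseq s t))%:R * (z - z')).
Proof. by move=> ss'; rewrite [LHS]circle_dist_mod1 ss' mulrBr. Qed.

Lemma mdist_circle_le1 (x y : circle R) : mdist x y <= 1.
Proof. exact: arc_le1. Qed.

Lemma take_mkseq s t n : (t <= n)%N -> take t (mkseq s n) = mkseq s t.
Proof. by move=> tn; rewrite /mkseq -map_take take_iota (minn_idPl tn). Qed.

Section spanning.
Variables (N q : nat).
Hypothesis q_gt0 : (0 < q)%N.

(** With W the multiplier of the word, the second component numbers the arc of length 1 / (q W) that
    contains the initial lift. *)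
Definition itinerary (sz : (nat -> 'I_k) * R) : seq 'I_k * nat :=
  (mkseq sz.1 N,
   Num.truncn (q%:R * (wprod l (mkseq sz.1 N))%:R * sz.2 : R)).

Definition itineraries : seq (seq 'I_k * nat) :=
  [seq (w, a) | w <- words k N, a <- iota 0 (q * wprod l w)].

Lemma size_itineraries : size itineraries = (q * S ^ N)%N.
Proof.
rewrite size_allpairs_dep sumnE big_map.
under eq_bigr do rewrite size_iota.
by rewrite -big_distrr /= sum_wprod.
Qed.

Lemma itinerary_mem sz : 0 <= sz.2 < 1 -> itinerary sz \in itineraries.
Proof.
move=> /andP[z0 z1]; apply/allpairsPdep.
exists (itinerary sz).1, (itinerary sz).2; split => //.
  by rewrite mem_words size_mkseq.
rewrite mem_iota /= add0n truncn_lt_nat// -?natrM; last by rewrite mulr_ge0.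
by rewrite gtr_pMr// ltr0n muln_gt0 q_gt0 wprod_gt0.
Qed.

(** Initial lifts in the same arc differ by at most 1 / (q W), and the multiplier at a time t <= N
    is at most W. *)
Lemma itinerary_close sz sz' t : 0 <= sz.2 -> 0 <= sz'.2 ->
  itinerary sz = itinerary sz' -> (t <= N)%N ->
  mdist (orbit_point sz.1 sz.2 t) (orbit_point sz'.1 sz'.2 t) <= q%:R^-1.
Proof.
case: sz sz' => [s z] [s' z'] /= z0 z'0 [ss' fz] tN.
have q0 : 0 < q%:R :> R by rewrite ltr0n.
rewrite mdist_orbit_point; last by rewrite -(take_mkseq s tN) ss' take_mkseq.
apply: le_trans (arc_le_norm _) _; rewrite normrM ger0_norm//.
rewrite -(take_mkseq s tN).
apply: (@le_trans _ _ ((wprod l (mkseq s N))%:R * `|z - z'|)).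
  by rewrite ler_wpM2r// ler_nat wprod_take_le.
rewrite -(ler_pM2l q0) mulfV ?lt0r_neq0// mulrA.
move: fz; rewrite -ss'; set W := q%:R * _ => fz.
have W0 : 0 <= W by rewrite mulr_ge0// ltW.
rewrite -[X in X * _](ger0_norm W0) -normrM mulrBr ler_norml.
have /andP[] := truncn_itv (mulr_ge0 W0 z0).
have /andP[] := truncn_itv (mulr_ge0 W0 z'0).
by rewrite -fz -natr1; lra.
Qed.

End spanning.

Lemma separated_card_le (e : R) : 0 < e -> exists2 C : R, 1 <= C &
  forall n (F : {fset orbit_space T}),
    bowen_separated (@orbit_shift _ _ _ T) n e F ->
    #|` F|%:R <= C * S%:R ^+ n.
Proof.
(* The division by 4 compensates the constant in [orbit_mdist_le]. *)
move=> e0; set c := e / 4; have c0 : 0 < c by rewrite divr_gt0.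
have [q0 q0E] : exists q, c^-1 < q%:R :> R.
  by exists (Num.truncn c^-1).+1; rewrite truncnS_gt.
have q_gt0 : (0 < q0)%N.
  by rewrite -(ltr0n R); apply: lt_trans q0E; rewrite invr_gt0.
have [m mE] : exists m, c^-1 <= (3 / 2) ^+ m :> R.
  exists q0.*2; apply: le_trans (ltW q0E) _.
  (* Bernoulli's inequality; the exponent 2 q0 makes the left side 1 + q0. *)
  have : 1 + q0.*2%:R * 2^-1 <= (3 / 2) ^+ q0.*2 :> R.
    have -> : (3 / 2 : R) = 1 + 2^-1 by lra.
    elim: (q0.*2) => [|j IH]; first by rewrite mul0r addr0.
    rewrite exprS -natr1; have : 0 <= j%:R :> R by [].
    set X := (1 + 2^-1) ^+ j in IH *; lra.
  by rewrite -mul2n natrM; lra.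
have [k0|k0] := posnP k.
  exists 1 => // n F _; have -> : F = fset0.
    apply/eqP/fset0Pn => -[x _]; have [[i ik] _] := orbit_seqP x 0.
    by rewrite k0 in ik.
  by rewrite cardfs0 mul1r exprn_ge0.
have S1 : 1 <= S%:R :> R.
  rewrite ler1n (bigD1 (Ordinal k0))//=.
  exact: leq_trans (ltnW (l_gt1 _)) (leq_addr _ _).
(* Itineraries are taken up to time n + m: the m extra steps cover the coordinates seen by the
   metric after time n, at a cost independent of n. Distinct points of a separated set have distinct
   itineraries. *)
exists (q0%:R * S%:R ^+ m) => [|n F sF].
  by apply: mulr_ege1; [rewrite ler1n|exact: exprn_ege1].
have [co coP] := boolp.choice orbit_of_ex.
rewrite -mulrA -exprD -natrX -natrM ler_nat addnC -size_itineraries.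
rewrite -(size_map (itinerary (n + m) q0 \o co)).
apply: uniq_leq_size => [|_ /mapP[x _ ->]]; last first.
  by apply: itinerary_mem => //; have [] := coP x.
rewrite map_inj_in_uniq ?fset_uniq// => x y xF yF /= xy; apply/eqP/negPn/negP => neq.
have [/andP[zx0 _] xE] := coP x; have [/andP[zy0 _] yE] := coP y.
have := sF x y xF yF neq; apply/negP; rewrite -leNgt.
apply: bigmax_le => [|i _]; first exact: ltW.
have -> : e = 4 * c by rewrite /c; lra.
apply: orbit_mdist_le => [|j]; first exact: ltW.
rewrite !iter_orbit_shift; have [ijN|ijN] := leqP (i + j) (n + m).
  rewrite xE yE; apply: le_trans (itinerary_close q_gt0 zx0 zy0 xy ijN) _.
  apply: (@le_trans _ _ c); first by rewrite invf_ple ?posrE ?ltr0n// ltW.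
  by rewrite ler_peMr ?(ltW c0)// exprn_ege1//; lra.
(* Here j > m because i < n, so the tolerance at j already exceeds 1, a bound for all distances on
   the circle. *)
apply: le_trans (mdist_circle_le1 _ _) _.
apply: (@le_trans _ _ (c * (3 / 2) ^+ m)).
  by rewrite -ler_pdivrMl// mulr1.
rewrite ler_pM2l//; apply: ler_weXn2l; first by lra.
by have := ltn_ord i; lia.
Qed.

End circle_orbits.
(** * Lower bound *)

Section separated_orbits.
Variables (R : realType) (k : nat) (T : continuous_action k (circle R)).
Variable l : 'I_k -> nat.
Hypothesis l_inj : injective l.
Hypothesis l_gt1 : forall i, (1 < l i)%N.
Hypothesis T_gen : forall (i : 'I_k) (a : R),
  generator T i (mod1 a) = mod1 ((l i)%:R * a).
(** Default letter that continues a finite word to an infinite sequence of generators. *)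
Variable i0 : 'I_k.

Notation S := (\sum_(i < k) l i)%N.

(* Every nonzero difference [l i - l j] divides [D]. *)
Notation D := (S`!).

Lemma letter_le i : (l i <= S)%N.
Proof. by rewrite (bigD1 i)//= leq_addr. Qed.

Lemma S_gt0 : (0 < S)%N.
Proof. exact: leq_trans (ltnW (l_gt1 i0)) (letter_le i0). Qed.

(** Backward induction from the common endpoint: [preimage_separation] identifies the last letter
    and the points one step earlier. *)
Lemma orbit_point_rigid (eps : R) s s' z z' N : S%:R * eps < 1 ->
  (forall t, (t <= N)%N ->
     D%:R * S%:R ^+ 2 * eps < arc (D%:R * ((wprod l (mkseq s t))%:R * z))) ->
  (forall t, (t < N)%N ->
     mdist (orbit_point l s z t) (orbit_point l s' z' t) <= eps) ->
  orbit_point l s z N = orbit_point l s' z' N ->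
  mkseq s N = mkseq s' N /\ mod1 z = mod1 z'.
Proof.
move=> Seps; elim: N => [|N IH] good close.
  by rewrite /orbit_point /wprod big_nil !mul1r.
have wE r x : (wprod l (mkseq r N.+1))%:R * x =
    (l (r N))%:R * ((wprod l (mkseq r N))%:R * x) :> R.
  by rewrite mkseqS wprod_rcons mulnC natrM mulrA.
have lS i : (0 < l i <= S)%N by rewrite letter_le ltnW.
have := close N (ltnSn N); rewrite [mdist _ _]circle_dist_mod1 => cN.
have := good N.+1 (leqnn _); rewrite /orbit_point !wE => gN eN.
have [ll yy] := preimage_separation (lS _) (lS _) (fact_gt0 _) (fun d => @dvdn_fact d _)
  Seps gN cN eN.
have [||ss zz] := IH _ _ yy.
- by move=> t tN; apply: good; exact: leqW.
- by move=> t tN; apply: close; exact: leqW.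
by rewrite !mkseqS ss (l_inj ll).
Qed.

(** * Backward paths in blocks of m steps *)

Section blocks.
Variable m : nat.

(** With W the multiplier of w and q this count, W < 4 D (q + 1) and 4 D q <= W; hence the shifts r
    = q + 1, ..., 2 q put (z + r) / W in the required interval for 0 <= z < 1. *)
Definition branch_count (w : seq 'I_k) : nat := (wprod l w %/ (4 * D))%N.

Definition branches : seq (seq 'I_k * nat) :=
  [seq (w, a) | w <- words k m, a <- iota 0 (branch_count w)].

(* Prepends the block [b.1] to a backward path starting at [e.2], moving to the
   preimage of [e.2] under [b.1] with number [branch_count b.1 + 1 + b.2]; these
   preimages lie in the interval [1 / (4 D), 3 / (4 D)]. *)
Definition extend (b : seq 'I_k * nat) (e : seq 'I_k * R) : seq 'I_k * R :=
  (b.1 ++ e.1, (e.2 + (branch_count b.1 + 1 + b.2)%:R) / (wprod l b.1)%:R).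

Fixpoint backward_paths (n : nat) : seq (seq 'I_k * R) :=
  if n is n'.+1 then [seq extend b e | b <- branches, e <- backward_paths n']
  else [:: ([::], (2 * D%:R)^-1)].

(** Invariant of [backward_paths]. The start lies in the middle half of [0, 1/D], so its D-th
    multiple is at least 1/4 away from the integers; going back through a block divides this by at
    most S^m, whence [central_far]. *)
Record central_path (n : nat) (e : seq 'I_k * R) : Prop := CentralPath {
  central_size : size e.1 = (n * m)%N ;
  central_start : 4^-1 <= D%:R * e.2 <= 3 / 4 ;
  central_end : mod1 ((wprod l e.1)%:R * e.2) = mod1 (2 * D%:R)^-1 ;
  central_far : forall t, (t <= n * m)%N ->
    (4 * S%:R ^+ m)^-1 <= arc (D%:R * ((wprod l (take t e.1))%:R * e.2))
}.

Lemma D_gt0 : 0 < D%:R :> R.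
Proof. by rewrite ltr0n fact_gt0. Qed.

Lemma central_itv n e : central_path n e -> 0 <= e.2 < 1.
Proof.
case=> _ /andP[z1 z2] _ _; have D1 : 1 <= D%:R :> R by rewrite ler1n fact_gt0.
have z0 : 0 <= e.2.
  by rewrite -(pmulr_rge0 _ D_gt0); apply: le_trans z1; rewrite invr_ge0.
rewrite z0 /=; apply: (@le_lt_trans _ _ (D%:R * e.2)); first by rewrite ler_peMl.
by lra.
Qed.

Lemma mem_branches b : b \in branches ->
  size b.1 = m /\ (b.2 < branch_count b.1)%N.
Proof.
move=> /allpairsPdep[w [a [+ + ->]]] /=.
by rewrite mem_words mem_iota => /eqP -> /=.
Qed.

Lemma central_extend n b e : b \in branches -> central_path n e ->
  central_path n.+1 (extend b e).
Proof.
move=> /mem_branches[sb bq] ce; have /andP[z0 z1] := central_itv ce.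
case: b sb bq => w a /= sw aq; case: e ce z0 z1 => u z [/= su zI eE far] z0 z1.
have W0 : 0 < (wprod l w)%:R :> R by rewrite ltr0n wprod_gt0.
rewrite /extend /=; set q := branch_count w in aq *; set z' := _ / _.
have Wz' : (wprod l w)%:R * z' = z + (q + 1 + a)%:R.
  by rewrite /z' mulrC divfK// lt0r_neq0.
have Dz : arc (D%:R * ((wprod l w)%:R * z')) = arc (D%:R * z).
  by rewrite Wz' mulrDr -natrM; apply: arc_mod1; exact: mod1Dnat.
have D0 := D_gt0.
have SR1 : 1 <= S%:R :> R by rewrite ler1n S_gt0.
split=> /=.
- by rewrite size_cat sw su mulSn.
(* From a < q follow q >= 1 and z + q + 1 + a < 2 q + 1 <= 3 q. *)
- have q1 : 1 <= q%:R :> R by rewrite ler1n; exact: leq_trans aq.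
  have a0 : 0 <= a%:R :> R by [].
  have aqR : a%:R + 1 <= q%:R :> R by rewrite natr1 ler_nat.
  have low : (wprod l w)%:R <= (q%:R + 1) * (4 * D%:R) :> R.
    by rewrite natr1 -!natrM ler_nat ltnW// ltn_ceil// muln_gt0 fact_gt0.
  have upp : q%:R * (4 * D%:R) <= (wprod l w)%:R :> R.
    by rewrite -!natrM ler_nat leq_trunc_div.
  rewrite -(ler_pM2r W0) -(ler_pM2r W0 (_ * _)).
  have -> : D%:R * z' * (wprod l w)%:R = D%:R * (z + (q%:R + 1 + a%:R)).
    by rewrite -mulrA [z' * _]mulrC Wz' !natrD.
  have h1 : D%:R * (q%:R + 1) <= D%:R * (z + (q%:R + 1 + a%:R)).
    by rewrite ler_pM2l//; lra.
  have h2 : D%:R * (z + (q%:R + 1 + a%:R)) <= D%:R * (3 * q%:R).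
    by rewrite ler_pM2l//; lra.
  by apply/andP; split; nra.
- rewrite wprod_cat natrM -mulrA mulrCA Wz' -eE mulrDr -natrM.
  exact: mod1Dnat.
(* Inside the new block the remaining letters multiply by at most S^m and lead to z modulo 1. After
   the block the points are those of the old path, up to integers. *)
- move=> t tn; rewrite take_cat sw; case: ltnP => tm.
    rewrite -(ler_pM2l (exprn_gt0 m (lt_le_trans ltr01 SR1))).
    apply: (@le_trans _ _ (arc (D%:R * z))).
      apply: (le_trans _ (arc_quarter zI)).
      by rewrite invfM mulrCA mulfV ?mulr1// lt0r_neq0// exprn_gt0// ltr0n S_gt0.
    rewrite -Dz -{1}(cat_take_drop t w) wprod_cat natrM.
    have -> : D%:R * ((wprod l (take t w))%:R * (wprod l (drop t w))%:R * z') =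
      (wprod l (drop t w))%:R * (D%:R * ((wprod l (take t w))%:R * z')) by ring.
    apply: le_trans (arc_natM _ _) _; rewrite ler_wpM2r ?arc_ge0// -natrX ler_nat.
    apply: leq_trans (wprod_le _ _) _; rewrite size_drop sw.
    by rewrite leq_pexp2l ?S_gt0// leq_subr.
  rewrite wprod_cat natrM.
  have -> : D%:R * ((wprod l w)%:R * (wprod l (take (t - m) u))%:R * z') =
     D%:R * ((wprod l (take (t - m) u))%:R * z)
     + (D * (wprod l (take (t - m) u) * (q + 1 + a)))%:R.
    by rewrite mulrAC Wz' !natrM; ring.
  rewrite (arc_mod1 (mod1Dnat _ _)); apply: far.
  by rewrite leq_subLR -mulSn.
Qed.

Lemma central_paths n e : e \in backward_paths n -> central_path n e.
Proof.
elim: n e => [|n IH] e.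
  rewrite inE => /eqP ->; have D0 := D_gt0.
  have Dz : D%:R * (2 * D%:R)^-1 = 2^-1 :> R.
    by rewrite invfM mulrCA mulfV ?mulr1// lt0r_neq0.
  split=> //=; rewrite /wprod ?Dz.
  - by lra.
  - by rewrite big_nil mul1r.
  move=> t _; rewrite big_nil mul1r Dz.
  apply: (@le_trans _ _ 4^-1); last by apply: arc_quarter; lra.
  rewrite lef_pV2 ?posrE ?ler_peMr ?mulr_gt0 ?exprn_gt0 ?ltr0n ?S_gt0//.
  by rewrite exprn_ege1// ler1n S_gt0.
by move=> /allpairsP[[b e'] [/= bB /IH e'P ->]]; exact: central_extend.
Qed.

(** Blocks have the fixed length m, so the concatenated word splits in one way; integer and
    fractional parts of the numerator then recover the shift and the old start. *)
Lemma backward_paths_uniq n : uniq (backward_paths n).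
Proof.
elim: n => [//|n IH] /=; apply: allpairs_uniq => //.
  by apply: allpairs_uniq_dep; [exact: words_uniq|move=> w _; exact: iota_uniq|
    move=> [w a] [w' a'] _ _ /= [-> ->]].
move=> [b e] [b' e'] /allpairsP[[c f] [/= cB fP [-> ->]]].
move=> /allpairsP[[c' f'] [/= c'B f'P [-> ->]]] /= {b e b' e'}.
have [sc _] := mem_branches cB; have [sc' _] := mem_branches c'B.
have fI := central_itv (central_paths fP).
have f'I := central_itv (central_paths f'P).
case: c cB sc => w a /= cB sw; case: c' c'B sc' => w' a' /= c'B sw'.
case: f fP fI => u z /= fP zI; case: f' f'P f'I => u' z' /= f'P z'I.
rewrite /extend /= => -[/eqP]; rewrite eqseq_cat ?sw ?sw'// => /andP[/eqP <- /eqP <-].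
have W0 : (wprod l w)%:R != 0 :> R by rewrite pnatr_eq0 -lt0n wprod_gt0.
move=> /(mulIf (invr_neq0 W0)) /(frac_inj zI z'I)[-> /addnI ->]; by [].
Qed.

Lemma size_backward_paths n : size (backward_paths n) = (size branches ^ n)%N.
Proof. by elim: n => [//|n IH] /=; rewrite size_allpairs IH expnS. Qed.

(** Every word of length m has multiplier at least 2^m >= 4 D, so rounding the quotient by 4 D down
    loses at most a factor 2; the multipliers sum to S^m. *)
Lemma size_branches : (4 * D <= 2 ^ m)%N ->
  S%:R ^+ m / (8 * D%:R) <= (size branches)%:R :> R.
Proof.
move=> Dm; have D0 := D_gt0.
rewrite ler_pdivrMr ?mulr_gt0// -natrX -(natrM _ 8) -natrM ler_nat.
rewrite size_allpairs_dep sumnE big_map -(sum_wprod l) big_distrl /=.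
rewrite big_seq [leqRHS]big_seq; apply: leq_sum => w.
rewrite mem_words size_iota => /eqP sw; rewrite /branch_count.
have D1 : (0 < 4 * D)%N by rewrite muln_gt0 fact_gt0.
have := ltn_ceil (wprod l w) D1.
have : (0 < wprod l w %/ (4 * D))%N.
  by rewrite divn_gt0// (leq_trans Dm)// -sw wprod_ge.
rewrite -[8%N]/(2 * 4)%N -mulnA.
move: (wprod l w) (4 * D)%N (wprod l w %/ _)%N => p d q q0 pq.
by rewrite mulnA; apply: leq_trans (ltnW pq) _; rewrite leq_mul2r; lia.
Qed.

Lemma mkseq_take (u : seq 'I_k) t : (t <= size u)%N ->
  mkseq (nth i0 u) t = take t u.
Proof. by move=> tu; rewrite -(take_mkseq _ tu) mkseq_nth. Qed.

(** Contrapositive of rigidity: all paths end at the same point, so two that stay [eps]-close have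
    the same word and the same start. *)
Lemma backward_paths_separated (eps : R) n e e' :
  S%:R * eps < 1 -> D%:R * S%:R ^+ 2 * eps < (4 * S%:R ^+ m)^-1 ->
  e \in backward_paths n -> e' \in backward_paths n -> e != e' ->
  exists2 t, (t < n * m)%N &
    eps < mdist (orbit_point l (nth i0 e.1) e.2 t)
                (orbit_point l (nth i0 e'.1) e'.2 t).
Proof.
move=> eps1 eps2 /central_paths ce /central_paths ce'.
apply: contraNP => far; have eI := central_itv ce; have e'I := central_itv ce'.
case: e e' ce ce' eI e'I far => [u z] [u' z'] [/= su _ eE eF] [/= su' _ e'E _] zI z'I far.
have [||||uu zz] := @orbit_point_rigid eps (nth i0 u) (nth i0 u') z z' (n * m).
- exact: eps1.
- move=> t tn; apply: lt_le_trans eps2 _; rewrite mkseq_take ?su//; exact: eF.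
- move=> t tn; rewrite leNgt; apply/negP => h; apply: far; by exists t.
- by rewrite /orbit_point !mkseq_take ?su ?su'// -{1}su -su' !take_size eE.
rewrite (mod1_inj zI z'I zz); move: uu.
by rewrite -{1}su -su' !mkseq_nth => ->.
Qed.

Lemma separated_set_ge (eps : R) n : 0 < eps ->
  S%:R * eps < 1 -> D%:R * S%:R ^+ 2 * eps < (4 * S%:R ^+ m)^-1 ->
  exists2 F : {fset orbit_space T},
    bowen_separated (@orbit_shift _ _ _ T) (n * m) eps F &
    #|` F| = (size branches ^ n)%N.
Proof.
move=> eps0 eps1 eps2.
pose orb (e : seq 'I_k * R) := orbit_of T_gen (nth i0 e.1) e.2.
have sep := backward_paths_separated eps1 eps2.
exists [fset x in map orb (backward_paths n)]%fset.
  move=> x y; rewrite !inE => /mapP[e eP ->] /mapP[e' e'P ->] ee'.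
  have [|t tn h] := sep _ _ _ eP e'P; first by apply: contraNN ee' => /eqP ->.
  by apply: lt_le_trans h _; exact: (mdist_le_bowen (orb e) (orb e') tn).
rewrite card_fseq undup_id ?size_map ?size_backward_paths//.
rewrite map_inj_in_uniq ?backward_paths_uniq// => e e' eP e'P ee'.
(* Equal orbits have distance 0 at the separating time, so distinct paths yield distinct orbits. *)
apply/eqP/negPn/negP => /(sep _ _ _ eP e'P)[t _].
have -> : orbit_point l (nth i0 e.1) e.2 t = orb e t by [].
by rewrite ee' mdistxx ltNge ltW.
Qed.

End blocks.

Lemma separated_growth_ge_ln (d : R) : 0 < d -> exists2 e0 : R, 0 < e0 &
  forall e : R, 0 < e <= e0 ->
  ((ln S%:R - d)%:E <= separated_growth (@orbit_shift _ _ _ T) e)%E.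
Proof.
move=> d0; have D0 := D_gt0; have S0 : 0 < S%:R :> R by rewrite ltr0n S_gt0.
have S1 : 1 <= S%:R :> R by rewrite ler1n S_gt0.
set c := ln (8 * D%:R : R).
have [m [m0 Dm cm]] : exists m,
    [/\ (0 < m)%N, (4 * D <= 2 ^ m)%N & c <= d * m%:R].
  (* The first entry gives 2^m > m >= 4 D; the second makes the loss c / m per step at most d. *)
  exists (maxn (4 * D) (Num.truncn (c / d)).+1); split.
  - by rewrite leq_max ltn0Sn orbT.
  - by apply: leq_trans (ltnW (ltn_expl _ _)); rewrite ?leq_maxl.
  - rewrite -ler_pdivrMl// mulrC; apply: le_trans (ltW (truncnS_gt _)) _.
    by rewrite ler_nat leq_maxr.
have B := size_branches Dm.
have B0 : 0 < S%:R ^+ m / (8 * D%:R) :> R by rewrite divr_gt0 ?exprn_gt0 ?mulr_gt0.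
(* Chosen so that D S^2 e0 is half of the required bound 1 / (4 S^m). *)
pose e0 : R := (8 * D%:R * S%:R ^+ m.+2)^-1.
have e00 : 0 < e0 by rewrite invr_gt0 mulr_gt0 ?exprn_gt0 ?mulr_gt0.
have Sm0 : 0 < S%:R ^+ m :> R by rewrite exprn_gt0.
have e0E : e0 * (8 * D%:R * (S%:R * (S%:R * S%:R ^+ m))) = 1.
  by rewrite -!exprS mulVf// lt0r_neq0// mulr_gt0 ?exprn_gt0 ?mulr_gt0.
have eps2 : D%:R * S%:R ^+ 2 * e0 < (4 * S%:R ^+ m)^-1.
  have q0 : 0 < 4 * S%:R ^+ m :> R by rewrite mulr_gt0.
  rewrite -(ltr_pM2r q0) mulVf ?lt0r_neq0//.
  have -> : D%:R * S%:R ^+ 2 * e0 * (4 * S%:R ^+ m) =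
    2^-1 * (e0 * (8 * D%:R * (S%:R * (S%:R * S%:R ^+ m)))).
    by field.
  by rewrite e0E; lra.
have eps1 : S%:R * e0 < 1.
  have D1 : 1 <= D%:R :> R by rewrite ler1n fact_gt0.
  have Sm1 : 1 <= S%:R ^+ m :> R by rewrite exprn_ege1.
  have h : 1 <= D%:R * (S%:R * S%:R ^+ m) :> R by rewrite !mulr_ege1.
  have : S%:R * e0 * (8 * (D%:R * (S%:R * S%:R ^+ m))) = 1 by rewrite -[RHS]e0E; ring.
  have Se0 : 0 < S%:R * e0 by rewrite mulr_gt0.
  by move: h Se0; move: (S%:R * e0) (D%:R * _) => X Y; nra.
exists e0 => // e /andP[e_gt0 ee0].
apply: (@le_trans _ _ (ln (size (branches m))%:R / m%:R)%:E); last first.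
  apply: separated_growth_ge => //; first exact: lt_le_trans B.
  move=> n; have [F sF cF] := separated_set_ge n e00 eps1 eps2.
  exists F; last by rewrite cF natrX.
  exact: bowen_separated_le sF.
rewrite lee_fin ler_pdivlMr ?ltr0n//.
have : ln (S%:R ^+ m / (8 * D%:R)) <= ln (size (branches m))%:R :> R.
  by rewrite ler_ln ?posrE// (lt_le_trans B0).
apply: le_trans; rewrite ln_div ?posrE ?mulr_gt0// lnXn// -/c mulrBl.
by rewrite mulr_natr lerD2l lerN2.
Qed.

End separated_orbits.

(** * The two bounds combined into the entropy formula *)

Theorem theorem3p1 (R : realType) (k : nat) (hk : (2 <= k)%N)
    (L : 'I_k -> int) (L_inj : injective L) (L_gt1 : forall i, 1 < L i)
    (T : continuous_action k (circle R))
    (T_gen : forall (i : 'I_k) (a : R),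
       generator T i (mod1 a) = mod1 ((L i)%:~R * a)) :
  friedland_entropy T = (ln (\sum_(i < k) (L i)%:~R : R))%:E.
Proof.
pose l i := `|L i|%N.
have lE i : L i = (l i)%:Z by rewrite /l; have := L_gt1 i; lia.
have l_gt1 i : (1 < l i)%N by have := L_gt1 i; rewrite lE.
have l_inj : injective l by move=> i j lij; apply: L_inj; rewrite !lE lij.
have gen i a : generator T i (mod1 a) = mod1 ((l i)%:R * a).
  by rewrite T_gen lE.
have -> : \sum_(i < k) (L i)%:~R = (\sum_(i < k) l i)%N%:R :> R.
  by rewrite natr_sum; apply: eq_bigr => i _; rewrite lE.
have i0 : 'I_k := Ordinal (ltnW hk).
apply: topological_entropyE => [e e0|d d0].
  have [C C1 HC] := separated_card_le l_gt1 gen e0.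
  by apply: separated_growth_le HC => //; rewrite ler1n (S_gt0 l_gt1 i0).
exact (separated_growth_ge_ln l_inj l_gt1 gen i0 d0).
Qed.
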